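(* Let $A$ be a real $m\times n$ matrix with full column rank ($m\ge n$) whose condition number satisfies $\kappa^2(A):=\sigma_{\max}^2(A)/\sigma_{\min}^2(A)\le e^{m/4}/3$. Let $b\in\mathbb{R}^m$ and let $x_*\in\mathbb{R}^n$ be a solution of the system $Ax=b$. For any initial estimate $x_0\in\mathbb{R}^n$, the block Gaussian Kaczmarz method with block size $s$ produces a sequence of iterates $\{x_k,\ k\ge 0\}$ that satisfies $$\mathbb{E}\|x_k-x_*\|_2^2\le\left(1-\frac{s}{15\,m\,\kappa^2(A)}\right)^k\|x_0-x_*\|_2^2 .$$
   Context: $\sigma_{\min}(A)$ and $\sigma_{\max}(A)$ denote the smallest and largest singular values of $A$, i.e. the smallest and largest eigenvalues of $\sqrt{A^TA}$. $M^\dagger$ denotes the Moore-Penrose inverse of a matrix $M$. Block Gaussian Kaczmarz (BGK) method with block size $s$ (a positive integer): starting from $x_0\in\mathbb{R}^n$, at each iteration a new $m\times s$ random matrix $S$ with i.i.d. standard normal entries is drawn, independently of all matrices drawn at previous iterations, and $$x_{k+1}=\bigl(\mathrm{Id}-(S^TA)^\dagger S^TA\bigr)x_k+(S^TA)^\dagger S^Tb .$$ The expectation $\mathbb{E}$ is over all the random matrices drawn.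
   Formalization: The formal statement adds the assumption s ≤ 15 m κ²(A), i.e. that the contraction factor 1 − s/(15 m κ²(A)) is nonnegative; otherwise the claim fails at k = 1 when x_0 ≠ x_*, since the left side is 0 and the right side is negative. *)

(* Defs.v *)
From HB Require Import structures.
From mathcomp Require Import all_boot all_order all_algebra.
From mathcomp Require Import all_classical all_reals all_analysis.

Set Implicit Arguments.
Unset Strict Implicit.
Unset Printing Implicit Defensive.

Import Order.TTheory GRing.Theory Num.Theory.
Import numFieldNormedType.Exports.

Local Open Scope classical_set_scope.
Local Open Scope ring_scope.

Section LinearAlgebra.
Context {R : realType}.

(* The canonical norm of matrices in MathComp-Analysis is the sup norm. *)
Definition norm2 n (x : 'cV[R]_n) : R := Num.sqrt (\sum_i x i 0 ^+ 2).

Definition psdmx n (M : 'M[R]_n) : Prop :=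
  M^T = M /\ forall x : 'cV[R]_n, 0 <= (x^T *m M *m x) 0 0.

(* The unique positive semidefinite square root of a positive semidefinite
   matrix; the default value 0 is only taken when M has no such root. *)
Definition sqrtmx n (M : 'M[R]_n) : 'M[R]_n :=
  xget 0 [set B | psdmx B /\ B *m B = M].

(* The set of eigenvalues of an n x n matrix is finite; for the symmetric
   matrix sqrtmx (A^T *m A) with 0 < n it is also nonempty, so that sup and inf
   are its maximum and minimum. *)
Definition sigma_max m n (A : 'M[R]_(m, n)) : R :=
  sup [set a | eigenvalue (sqrtmx (A^T *m A)) a].

Definition sigma_min m n (A : 'M[R]_(m, n)) : R :=
  inf [set a | eigenvalue (sqrtmx (A^T *m A)) a].

(* The squared condition number. *)
Definition kappa2 m n (A : 'M[R]_(m, n)) : R :=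
  sigma_max A ^+ 2 / sigma_min A ^+ 2.

(* The four Penrose equations. *)
Definition is_moore_penrose m n (M : 'M[R]_(m, n)) (X : 'M[R]_(n, m)) : Prop :=
  [/\ M *m X *m M = M, X *m M *m X = X,
      (M *m X)^T = M *m X & (X *m M)^T = X *m M].

(* They have exactly one solution, so the default value 0 plays no role. *)
Definition pinvmp m n (M : 'M[R]_(m, n)) : 'M[R]_(n, m) :=
  xget 0 [set X | is_moore_penrose M X].

Fixpoint bgk m n s (A : 'M[R]_(m, n)) (b : 'cV[R]_m) (S : nat -> 'M[R]_(m, s))
    (x0 : 'cV[R]_n) (k : nat) : 'cV[R]_n :=
  if k is k'.+1 then
    let M := (S k')^T *m A in
    (1%:M - pinvmp M *m M) *m bgk A b S x0 k' + pinvmp M *m ((S k')^T *m b)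
  else x0.

End LinearAlgebra.

Section Probability.
Context d (T : measurableType d) (R : realType) (P : probability T R).

Definition mutually_independent (I : choiceType) (X : I -> {RV P >-> R}) :=
  forall (J : seq I) (B : I -> set R),
    uniq J -> (forall i, measurable (B i)) ->
    P (\bigcap_(i in [set` J]) (X i @^-1` B i)) =
      (\prod_(i <- J) P (X i @^-1` B i))%E.

(* normal_prob is defined on all sets by an integral; only its values on
   measurable sets are meaningful. *)
Definition std_normal (X : {RV P >-> R}) :=
  forall B : set R, measurable B -> distribution P X B = normal_prob 0 1 B.

Definition iid_std_normal (I : choiceType) (X : I -> {RV P >-> R}) :=
  (forall i, std_normal (X i)) /\ mutually_independent X.

(* The k-th random matrix of a family of random entries indexed by
   (iteration, row, column). Mutual independence of the whole family says both
   that the entries of each matrix are independent and that each matrix is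
   independent of the others. *)
Definition random_mx m s (G : nat * 'I_m * 'I_s -> {RV P >-> R})
    (w : T) (k : nat) : 'M[R]_(m, s) :=
  \matrix_(i < m, j < s) G (k, i, j) w.

End Probability.

(* Main.v *)
Require Import Defs.
From HB Require Import structures.
From mathcomp Require Import all_boot all_order all_algebra.
From mathcomp Require Import all_classical all_reals all_analysis.
From mathcomp Require Import perm complex measurable_realfun ring lra.

Set Implicit Arguments.
Unset Strict Implicit.
Unset Printing Implicit Defensive.

Import Order.TTheory GRing.Theory Num.Theory.
Import numFieldNormedType.Exports.

Local Open Scope classical_set_scope.
Local Open Scope ring_scope.

(** Subtracting the solution turns the method into [z_(k+1) = (1 - M^+ M) z_k]
    with [M = S^T A], and [1 - M^+ M] is the orthogonal projector onto the
    orthogonal complement of the vectors [A^T g], where [g] runs over the columns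
    of [S] ([bgk_errorE], [pinvmp_proj]). The proof takes these [s] directions one
    at a time, as in the Gram-Schmidt process. If [Q] is the projector after some
    of them and [r = Q z_k] is the current error, the next column [g] removes from
    [|r|^2] the amount [(g . A r)^2 / |Q A^T g|^2], which is at least
    [(g . A r)^2 / (sigma_max(A)^2 |g|^2)] ([sweep_error_decrease]).

    The vector [A r] depends only on the other random entries, and the direction
    [g / |g|] has second moment matrix [Id / m], so the mean of this lower bound is
    [E|A r|^2 / (m sigma_max(A)^2)], which is at least [x E|r|^2] with
    [x = 1 / (m kappa2 A)] ([mean_sqr_direction], [mean_sq_rcons]). Only two
    symmetries of the law are used for the second moments: changing the sign of one
    entry and exchanging two entries of [g]. They are applied to the joint law of
    all entries, so that no conditional expectation is required. One column thus
    multiplies the mean square error by at most [1 - x], and one iteration by at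
    most [(1 - x)^s] ([mean_sq_le]).

    If [s] is smaller than the dimension [n], then [s x <= 1] and
    [(1 - x)^s <= 1 - s x / 2 <= 1 - s x / 15] ([geometric_rate_le]). If [s] is at
    least [n], the geometric rate does not suffice, because [1 - s x / 15] may
    vanish. In that case every column almost surely lowers the rank of [Q] until
    [Q = 0]: if [Q] is nonzero and [Q A^T g = 0], then one entry of [g] equals
    a function of the other entries, which has probability zero because the normal
    law has no atoms ([ae_rank_drop]). The error is then almost surely zero after
    one iteration ([mean_sq_eq0]).

    The extreme singular values enter only through
    [sigma_min(A)^2 |z|^2 <= |A z|^2 <= sigma_max(A)^2 |z|^2]
    ([singular_value_bounds]). They are defined from the positive square root of
    [A^T A], whose existence and spectral bounds come from evaluating
    interpolating polynomials at a symmetric matrix ([psdmx_horner]). *)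

(** * Inner product of column vectors *)

Section Dot.
Context {R : realType}.

Definition dot n (x y : 'cV[R]_n) : R := (x^T *m y) 0 0.

Lemma dotE n (x y : 'cV[R]_n) : dot x y = \sum_i x i 0 * y i 0.
Proof. by rewrite /dot mxE; apply: eq_bigr => i _; rewrite mxE. Qed.

Lemma dotC n (x y : 'cV[R]_n) : dot x y = dot y x.
Proof. by rewrite !dotE; apply: eq_bigr => i _; rewrite mulrC. Qed.

Lemma dotDr n (x y z : 'cV[R]_n) : dot x (y + z) = dot x y + dot x z.
Proof. by rewrite /dot mulmxDr mxE. Qed.

Lemma dotZr n c (x y : 'cV[R]_n) : dot x (c *: y) = c * dot x y.
Proof. by rewrite /dot -scalemxAr mxE. Qed.

Lemma dotNr n (x y : 'cV[R]_n) : dot x (- y) = - dot x y.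
Proof. by rewrite /dot mulmxN mxE. Qed.

Lemma dotDl n (x y z : 'cV[R]_n) : dot (y + z) x = dot y x + dot z x.
Proof. by rewrite !(dotC _ x) dotDr. Qed.

Lemma dotZl n c (x y : 'cV[R]_n) : dot (c *: y) x = c * dot y x.
Proof. by rewrite !(dotC _ x) dotZr. Qed.

Lemma dotNl n (x y : 'cV[R]_n) : dot (- y) x = - dot y x.
Proof. by rewrite !(dotC _ x) dotNr. Qed.

Lemma dot0r n (x : 'cV[R]_n) : dot x 0 = 0.
Proof. by rewrite /dot mulmx0 mxE. Qed.

Lemma dot_mull m n (B : 'M[R]_(m, n)) x y : dot (B *m x) y = dot x (B^T *m y).
Proof. by rewrite /dot trmx_mul mulmxA. Qed.

Lemma dot_ge0 n (x : 'cV[R]_n) : 0 <= dot x x.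
Proof. by rewrite dotE sumr_ge0// => i _; rewrite -expr2 sqr_ge0. Qed.

Lemma dot_eq0 n (x : 'cV[R]_n) : (dot x x == 0) = (x == 0).
Proof.
apply/eqP/eqP => [|->]; last by rewrite dot0r.
rewrite dotE => /psumr_eq0P x0; apply/colP => i; rewrite mxE.
apply/eqP; rewrite -sqrf_eq0 expr2; apply/eqP/x0 => // j _.
by rewrite -expr2 sqr_ge0.
Qed.

Lemma norm2_sqr n (x : 'cV[R]_n) : norm2 x ^+ 2 = dot x x.
Proof.
rewrite /norm2 sqr_sqrtr ?dotE; first by apply: eq_bigr => i _.
by apply: sumr_ge0 => i _; rewrite sqr_ge0.
Qed.

Lemma mul_col_dot n (x y z : 'cV[R]_n) : x *m y^T *m z = dot y z *: x.
Proof.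
by rewrite -mulmxA [_^T *m _]mx11_scalar mul_mx_scalar.
Qed.

End Dot.

(** * Orthogonal projectors built one direction at a time *)

Section Deflation.
Context {R : realType}.

(** If [Q] is the orthogonal projector onto a subspace, this is the projector
    onto its part orthogonal to [a], i.e. one Gram-Schmidt step. When [Q *m a]
    vanishes the convention [0^-1 = 0] leaves [Q] unchanged, so no case
    distinction is needed, and the entries stay rational functions of the data,
    which makes measurability elementary. *)
Definition deflate n (Q : 'M[R]_n) (a : 'cV[R]_n) : 'M[R]_n :=
  let q := Q *m a in Q - (dot q q)^-1 *: (q *m q^T).

Definition orthoproj n (s : seq 'cV[R]_n) : 'M[R]_n :=
  foldl (@deflate n) 1%:M s.

Lemma deflate_mul n (Q : 'M[R]_n) (a z : 'cV[R]_n) :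
  let q := Q *m a in
  deflate Q a *m z = Q *m z - (dot q q)^-1 *: (dot q z *: q).
Proof. by rewrite /deflate mulmxBl -scalemxAl mul_col_dot. Qed.

Lemma deflateT n (Q : 'M[R]_n) a : Q^T = Q -> (deflate Q a)^T = deflate Q a.
Proof.
by move=> Qs; rewrite /deflate linearB/= linearZ/= trmx_mul trmxK Qs.
Qed.

Lemma dot_proj n (Q : 'M[R]_n) (x y : 'cV[R]_n) : Q^T = Q -> Q *m Q = Q ->
  dot (Q *m x) (Q *m y) = dot x (Q *m y).
Proof. by move=> Qs QQ; rewrite dot_mull Qs mulmxA QQ. Qed.

Lemma dot_proj_le n (Q : 'M[R]_n) (x : 'cV[R]_n) : Q^T = Q -> Q *m Q = Q ->
  dot (Q *m x) (Q *m x) <= dot x x.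
Proof.
move=> Qs QQ; have := dot_ge0 (x - Q *m x).
rewrite dotDl !dotDr !dotNl !dotNr dot_proj// (dotC _ x) opprK addNr addr0.
by rewrite subr_ge0.
Qed.

Lemma normalize_dot n (q : 'cV[R]_n) : (dot q q)^-1 *: (dot q q *: q) = q.
Proof.
have [->|q0] := eqVneq q 0; first by rewrite !scaler0.
by rewrite scalerA mulVf ?scale1r// dot_eq0.
Qed.

Lemma deflate_idem n (Q : 'M[R]_n) a : Q^T = Q -> Q *m Q = Q ->
  deflate Q a *m deflate Q a = deflate Q a.
Proof.
move=> Qs QQ; set q := Q *m a; have Qq : Q *m q = q by rewrite mulmxA QQ.
have -> : deflate Q a *m deflate Q a = deflate Q a *m Q -
    (dot q q)^-1 *: (deflate Q a *m q *m q^T).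
  by rewrite {2}/deflate mulmxBr -scalemxAr mulmxA.
rewrite deflate_mul -/q Qq normalize_dot subrr mul0mx scaler0 subr0.
rewrite /deflate -/q mulmxBl QQ -scalemxAl -mulmxA.
by rewrite -{2}Qs -trmx_mul Qq.
Qed.

Lemma deflate_self n (Q : 'M[R]_n) (a : 'cV[R]_n) : Q^T = Q -> Q *m Q = Q ->
  deflate Q a *m a = 0.
Proof.
move=> Qs QQ; rewrite deflate_mul /= (dotC _ a) -(dot_proj a a Qs QQ).
by rewrite normalize_dot subrr.
Qed.

Lemma deflate_ker n (Q : 'M[R]_n) (a b : 'cV[R]_n) : Q^T = Q -> Q *m b = 0 ->
  deflate Q a *m b = 0.
Proof.
move=> Qs Qb; have qb : dot (Q *m a) b = 0 by rewrite dot_mull Qs Qb dot0r.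
by rewrite deflate_mul /= qb Qb scale0r scaler0 subrr.
Qed.

(** Pythagoras: the square of the component removed by one deflation. This is
    the identity from which the contraction rate is read off. *)
Lemma deflate_norm n (Q : 'M[R]_n) a z : Q^T = Q -> Q *m Q = Q ->
  dot (deflate Q a *m z) (deflate Q a *m z) =
  dot (Q *m z) (Q *m z) - dot a (Q *m z) ^+ 2 / dot (Q *m a) (Q *m a).
Proof.
move=> Qs QQ; have DD := deflate_idem a Qs QQ; have Ds := deflateT a Qs.
rewrite (dot_proj _ _ Ds DD) deflate_mul /= dotDr dotNr !dotZr.
rewrite (dot_proj z z Qs QQ).
by rewrite (dotC z (Q *m a)) (dot_mull Q a z) Qs -expr2 mulrC.
Qed.

(** Counts dimensions: a deflation lowers the rank exactly when the new direction
    is not yet killed. *)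
Lemma deflate_trace n (Q : 'M[R]_n) a :
  \tr (deflate Q a) = \tr Q - (Q *m a != 0)%:R.
Proof.
rewrite /deflate linearB/= linearZ/= mxtrace_mulC trace_mx11 -/(dot _ _).
rewrite -dot_eq0.
by have [->|q0] := eqVneq; rewrite ?mulr0// mulVf.
Qed.

Lemma deflate_sub p n (M : 'M[R]_(p, n)) (Q : 'M[R]_n) a : Q^T = Q ->
  (1%:M - Q <= M)%MS -> (a^T <= M)%MS -> (1%:M - deflate Q a <= M)%MS.
Proof.
move=> Qs QM aM; rewrite /deflate opprB addrCA addrC addmx_sub//.
rewrite scalemx_sub// mulmx_sub// trmx_mul Qs.
rewrite (_ : a^T *m Q = a^T - a^T *m (1%:M - Q)).
  by rewrite addmx_sub// eqmx_opp mulmx_sub.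
by rewrite mulmxBr mulmx1 opprB addrC subrK.
Qed.

Lemma orthoproj_rcons n (s : seq 'cV[R]_n) a :
  orthoproj (rcons s a) = deflate (orthoproj s) a.
Proof. by rewrite /orthoproj -cats1 foldl_cat. Qed.

Lemma orthoprojP n (s : seq 'cV[R]_n) :
  (orthoproj s)^T = orthoproj s /\ orthoproj s *m orthoproj s = orthoproj s.
Proof.
elim/last_ind: s => [|s a [Qs QQ]]; first by rewrite /orthoproj/= trmx1 mulmx1.
by rewrite orthoproj_rcons deflateT// deflate_idem.
Qed.

Lemma orthoproj_ker n (s : seq 'cV[R]_n) a : a \in s -> orthoproj s *m a = 0.
Proof.
elim/last_ind: s => [//|s b IH]; have [Qs QQ] := orthoprojP s.
rewrite mem_rcons inE orthoproj_rcons => /predU1P[->|/IH sa].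
  exact: deflate_self.
exact: deflate_ker.
Qed.

Lemma orthoproj_sub p n (M : 'M[R]_(p, n)) (s : seq 'cV[R]_n) :
  {in s, forall a, (a^T <= M)%MS} -> (1%:M - orthoproj s <= M)%MS.
Proof.
elim/last_ind: s => [_|s b IH sM]; first by rewrite subrr sub0mx.
have [Qs _] := orthoprojP s; rewrite orthoproj_rcons deflate_sub//.
  by apply: IH => a sa; apply: sM; rewrite mem_rcons inE sa orbT.
by apply: sM; rewrite mem_rcons inE eqxx.
Qed.

(** The trace of an orthogonal projector is its squared Frobenius norm. *)
Lemma proj_trace_le0 n (Q : 'M[R]_n) : Q^T = Q -> Q *m Q = Q ->
  \tr Q <= 0 -> Q = 0.
Proof.
move=> Qs QQ trQ_le0; have trQ : \sum_j dot (col j Q) (col j Q) = \tr Q.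
  transitivity (\tr (Q^T *m Q)); last by rewrite Qs QQ.
  apply: eq_bigr => k _; rewrite mxE dotE.
  by apply: eq_bigr => l _; rewrite !mxE.
have trQ_ge0 : 0 <= \tr Q by rewrite -trQ sumr_ge0// => j _; exact: dot_ge0.
have /psumr_eq0P Q0 : \sum_j dot (col j Q) (col j Q) = 0.
  by rewrite trQ; apply/eqP; rewrite eq_le trQ_le0.
apply/matrixP => i j; have /eqP := Q0 (fun j _ => dot_ge0 _) j isT.
by rewrite dot_eq0 => /eqP/colP/(_ i); rewrite !mxE.
Qed.

End Deflation.

(** * The projector attached to the Moore-Penrose inverse *)

Section MoorePenrose.
Context {R : realType}.

(** A row vector [v] killed by the Gram matrix satisfies [|v B|^2 = 0]. *)
Lemma gram_unitmx p n (B : 'M[R]_(p, n)) : row_free B -> B *m B^T \in unitmx.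
Proof.
move=> Bfree; rewrite -row_free_unit -kermx_eq0; apply/rowV0P => v /sub_kermxP.
rewrite mulmxA => vB0; apply: (row_free_inj Bfree); rewrite mul0mx.
apply: trmx_inj; rewrite trmx0; apply/eqP; rewrite -dot_eq0 /dot trmxK.
by rewrite trmx_mul mulmxA vB0 mul0mx mxE.
Qed.

(** The orthogonal projector onto the row space, written as a left multiple of
    [M]; it is [B^T (B B^T)^-1 B] for a basis [B] of the rows. *)
Lemma rowspace_projector p n (M : 'M[R]_(p, n)) :
  exists Z : 'M[R]_(n, p), (Z *m M)^T = Z *m M /\ M *m (Z *m M) = M.
Proof.
move: (row_base M) (row_base_free M) (eq_row_base M) => B /gram_unitmx Bu BM.
pose Pi := B^T *m invmx (B *m B^T) *m B.
have /submxP[Z ZM] : (Pi <= M)%MS by rewrite -BM submxMl.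
have /submxP[W WB] : (M <= B)%MS by rewrite BM.
exists Z; rewrite -ZM; split.
  by rewrite /Pi !trmx_mul trmxK trmx_inv trmx_mul trmxK mulmxA.
by rewrite WB -mulmxA; congr (_ *m _); rewrite !mulmxA mulmxV// mul1mx.
Qed.

(** With [Z M] and [M W] the orthogonal projectors onto the row and column
    spaces, [Z M W] satisfies the four Penrose equations. *)
Lemma moore_penrose_exists p n (M : 'M[R]_(p, n)) :
  exists X, is_moore_penrose M X.
Proof.
have [Z [ZMs MZM]] := rowspace_projector M.
have [W' [WMs MWM]] := rowspace_projector M^T.
pose W := W'^T; have MWs : (M *m W)^T = M *m W.
  by rewrite -[M in M *m W]trmxK -trmx_mul trmxK WMs.
have {}MWM : M *m W *m M = M.
  apply: trmx_inj; rewrite -[RHS]MWM trmx_mul MWs -[M *m W]MWs.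
  by rewrite trmx_mul trmxK.
have ZMWM : Z *m M *m W *m M = Z *m M by rewrite -!mulmxA (mulmxA M) MWM.
have MZMW : M *m (Z *m M *m W) = M *m W by rewrite mulmxA MZM.
exists (Z *m M *m W); split; rewrite ?MZMW ?ZMWM//.
by rewrite -[_ *m (Z *m M *m W)]mulmxA MZMW !mulmxA.
Qed.

Lemma pinvmpP p n (M : 'M[R]_(p, n)) : is_moore_penrose M (pinvmp M).
Proof.
have [X XP] := moore_penrose_exists M.
by rewrite /pinvmp; case: xgetP => // /(_ X).
Qed.

(** Identifies the matrix of one Kaczmarz step: a symmetric matrix that vanishes
    on the rows of [M] and differs from the identity by an element of the row
    space must be the projector [1 - M^+ M]. *)
Lemma pinvmp_proj p n (M : 'M[R]_(p, n)) (Q : 'M[R]_n) :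
  Q^T = Q -> M *m Q = 0 -> (1%:M - Q <= M)%MS -> 1%:M - pinvmp M *m M = Q.
Proof.
move=> Qs MQ /submxP[Z ZM]; have [MXM _ _ XMs] := pinvmpP M.
set X := pinvmp M in MXM XMs *.
suff -> : X *m M = 1%:M - Q by rewrite opprB addrC subrK.
have XMQ : X *m M *m (1%:M - Q) = X *m M.
  by rewrite mulmxBr mulmx1 -mulmxA MQ mulmx0 subr0.
have QXM : (1%:M - Q) *m (X *m M) = 1%:M - Q.
  by rewrite ZM -mulmxA [M *m _]mulmxA MXM.
by rewrite -[LHS]XMs -XMQ trmx_mul XMs linearB/= trmx1 Qs.
Qed.

End MoorePenrose.

(** * Polynomial functional calculus of real symmetric matrices *)

Section Spectral.
Context {R : realType}.

Lemma trmx_horner_mx n (A : 'M[R]_n.+1) (p : {poly R}) :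
  (horner_mx A p)^T = horner_mx A^T p.
Proof.
elim/poly_ind: p => [|p c IH]; first by rewrite !rmorph0 trmx0.
rewrite !(rmorphD, rmorphM)/= !horner_mx_X !horner_mx_C linearD/= tr_scalar_mx.
rewrite -IH [X in X + _]trmx_mul; congr (_ + _).
by rewrite -[_ *m _]/(_ * _) IH; apply: (comm_mx_horner _ (erefl _)).
Qed.

(** Diagonalize over an algebraically closed field [C] containing [R] as its real
    elements: a Hermitian matrix has real eigenvalues and is diagonalizable, so a
    real polynomial vanishing on them kills [A]. *)
Lemma symmetric_eigenvalues_closed (C : numClosedFieldType)
    (f : {rmorphism R -> C}) n (A : 'M[R]_n.+1) :
    (forall x, f x \is Num.real) ->
    (forall z : C, z \is Num.real -> exists x, z = f x) ->
  A^T = A ->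
  exists2 s : seq R, (forall a, eigenvalue A a = (a \in s)) &
    s != [::] /\
    forall p : {poly R}, {in s, forall a, p.[a] = 0} -> horner_mx A p = 0.
Proof.
move=> freal fsurj Asym; pose AC := map_mx f A.
have ACherm : AC \is hermsymmx.
  apply: realsym_hermsym.
    apply/is_hermitianmxP; rewrite expr0 scale1r map_mx_id//.
    by rewrite /AC map_trmx Asym.
  by apply/mxOverP => i j; rewrite mxE freal.
have /hermitian_normalmx/orthomx_spectralP ACE := ACherm.
have /mxOverP dreal := hermitian_spectral_diag_real ACherm.
set P := spectralmx AC in ACE; set d := spectral_diag AC in ACE dreal.
have Pu : P \in unitmx by exact: spectral_unit.
have [r dE] : exists r : 'I_n.+1 -> R, forall i, d 0 i = f (r i).
  by have [r] := choice (fun i => fsurj _ (dreal 0 i)); exists r.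
have hornerC (p : {poly R}) : map_mx f (horner_mx A p) =
    invmx P *m diag_mx (\row_i f p.[r i]) *m P.
  rewrite map_horner_mx -/AC ACE horner_mx_uconjC// horner_mx_diag.
  congr (_ *m diag_mx _ *m _); apply/rowP => i.
  by rewrite !mxE dE horner_map.
have p0 (p : {poly R}) : (forall i, p.[r i] = 0) -> horner_mx A p = 0.
  move=> p0; apply/eqP; rewrite -(map_mx_eq0 f); apply/eqP.
  rewrite hornerC (_ : \row_i _ = 0) ?linear0 ?mulmx0 ?mul0mx//.
  by apply/rowP => i; rewrite !mxE p0 rmorph0.
pose s := [seq r i | i <- enum 'I_n.+1].
have rs i : r i \in s by apply/map_f; rewrite mem_enum.
exists s; last split.
- move=> a; apply/idP/idP => [|/mapP[i _ ->]].
    rewrite eigenvalue_root_char -root_mxminpoly => ra.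
    suff : root (\prod_(c <- s) ('X - c%:P)) a by rewrite root_prod_XsubC.
    apply: root_dvdp ra; rewrite dvd_mxminpoly; apply/eqP/p0 => i.
    by apply/eqP; rewrite -[_ == _]/(root _ _) root_prod_XsubC.
  rewrite eigenvalue_root_char -(fmorph_root f) map_char_poly.
  rewrite -eigenvalue_root_char -/AC -dE; apply/eigenvalueP.
  exists (row i P); first rewrite -row_mul ACE !mulmxA mulmxV// mul1mx.
    by apply/rowP => j; rewrite row_mul row_diag_mx -scalemxAl -rowE.
  apply/eqP => Pi0; have : row i (P *m invmx P) = 0.
    by rewrite row_mul Pi0 mul0mx.
  rewrite mulmxV// => /rowP/(_ i)/eqP.
  by rewrite !mxE eqxx oner_eq0.
- by rewrite -size_eq0 size_map size_enum_ord.
- by move=> p sp; apply: p0 => i; apply: sp.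
Qed.

Lemma symmetric_eigenvalues n (A : 'M[R]_n.+1) : A^T = A ->
  exists2 s : seq R, (forall a, eigenvalue A a = (a \in s)) &
    s != [::] /\
    forall p : {poly R}, {in s, forall a, p.[a] = 0} -> horner_mx A p = 0.
Proof.
apply: (@symmetric_eigenvalues_closed R[i] (real_complex R)) => [x|z zr].
  by rewrite complex_real.
by exists (complex.Re z); apply/esym/RRe_real.
Qed.

Lemma interpolation (s : seq R) (f : R -> R) :
  exists p : {poly R}, {in s, forall a, p.[a] = f a}.
Proof.
elim: s => [|a s [p pf]]; first by exists 0.
have [as_|as_] := boolP (a \in s).
  by exists p => b; rewrite inE => /predU1P[->|]; exact: pf.
pose q : {poly R} := \prod_(c <- s) ('X - c%:P).
have q0 b : (q.[b] == 0) = (b \in s) by rewrite -root_prod_XsubC.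
exists (p + ((f a - p.[a]) / q.[a]) *: q) => b; rewrite inE => /predU1P[->|bs].
  by rewrite !hornerE divfK ?q0// addrC subrK.
by rewrite !hornerE pf// (eqP (_ : q.[b] == 0)) ?q0// mulr0 addr0.
Qed.

Lemma psdmx_sqr n (B : 'M[R]_n) : B^T = B -> psdmx (B *m B).
Proof.
move=> Bs; split=> [|x]; first by rewrite trmx_mul Bs.
rewrite mulmxA -[x^T *m B *m B *m x]mulmxA -[X in X *m (B *m x)](trmxK).
rewrite trmx_mul trmxK Bs mxE sumr_ge0// => i _.
by rewrite mxE -expr2 sqr_ge0.
Qed.

(** [p] agrees on the spectrum with the square of a polynomial interpolating
    [sqrt p], hence [horner_mx A p] is the square of a symmetric matrix. *)
Lemma psdmx_horner n (A : 'M[R]_n.+1) (p : {poly R}) : A^T = A ->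
  (forall a, eigenvalue A a -> 0 <= p.[a]) -> psdmx (horner_mx A p).
Proof.
move=> Asym p_ge0; have [s sE [_ s0]] := symmetric_eigenvalues Asym.
have [r rE] := interpolation s (fun a => Num.sqrt p.[a]).
have -> : horner_mx A p = horner_mx A r *m horner_mx A r.
  rewrite -[_ *m _]/(_ * _) -rmorphM/=.
  apply/eqP; rewrite -subr_eq0 -rmorphB/=; apply/eqP/s0 => a sa.
  by rewrite !hornerE rE// -expr2 sqr_sqrtr ?subrr// p_ge0// sE.
by apply: psdmx_sqr; rewrite trmx_horner_mx Asym.
Qed.

Lemma psdmx_eigenvalue_ge0 n (B : 'M[R]_n) a :
  psdmx B -> eigenvalue B a -> 0 <= a.
Proof.
move=> [_ Bpsd] /eigenvalueP[v vB v0].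
have := Bpsd v^T; rewrite trmxK vB -scalemxAl mxE.
rewrite pmulr_lge0// mxE lt0r sumr_ge0 ?andbT; last first.
  by move=> i _; rewrite mxE -expr2 sqr_ge0.
apply: contra v0 => /eqP/psumr_eq0P v0; apply/eqP/rowP => i; rewrite mxE.
apply/eqP; rewrite -sqrf_eq0 expr2; apply/eqP.
by have := v0 _ i isT; rewrite mxE; apply=> j _; rewrite mxE -expr2 sqr_ge0.
Qed.

(** A polynomial interpolating the square root on the spectrum of [M], evaluated
    at [M], is a positive semidefinite square root. *)
Lemma sqrtmxP n (M : 'M[R]_n.+1) : psdmx M ->
  psdmx (sqrtmx M) /\ sqrtmx M *m sqrtmx M = M.
Proof.
move=> Mpsd; have [Msym _] := Mpsd.
have [s sE [_ s0]] := symmetric_eigenvalues Msym.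
have [r rE] := interpolation s Num.sqrt.
rewrite /sqrtmx; case: xgetP => // /(_ (horner_mx M r))[]; split.
  by apply: psdmx_horner => // a; rewrite sE => sa; rewrite rE// sqrtr_ge0.
rewrite -[_ *m _]/(_ * _) -rmorphM/= -[RHS](horner_mx_X M).
apply/eqP; rewrite -subr_eq0 -rmorphB/=; apply/eqP/s0 => a sa.
rewrite !hornerE rE// -expr2 sqr_sqrtr ?subrr//.
by apply: (psdmx_eigenvalue_ge0 Mpsd); rewrite sE.
Qed.

End Spectral.

(** * Extreme singular values *)

Section SingularValues.
Context {R : realType}.

Lemma gram_psd m n (A : 'M[R]_(m, n)) : psdmx (A^T *m A).
Proof.
split=> [|x]; first by rewrite trmx_mul trmxK.
by rewrite !mulmxA -trmx_mul -mulmxA dot_ge0.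
Qed.

(** Both bounds say that a polynomial, [X^2 - c] or [c - X^2], is nonnegative on
    the spectrum of [B]. *)
Lemma sqr_psd_bounds n (B : 'M[R]_n.+1) (c : R) (x : 'cV[R]_n.+1) : B^T = B ->
  ((forall a, eigenvalue B a -> c <= a ^+ 2) ->
    c * dot x x <= dot x (B *m B *m x)) /\
  ((forall a, eigenvalue B a -> a ^+ 2 <= c) ->
    dot x (B *m B *m x) <= c * dot x x).
Proof.
move=> Bs; have hornerE1 : horner_mx B ('X^2 - c%:P) = B *m B - c%:M.
  by rewrite rmorphB/= rmorphXn/= horner_mx_X horner_mx_C expr2.
have hornerE2 : horner_mx B (c%:P - 'X^2) = c%:M - B *m B.
  by rewrite rmorphB/= rmorphXn/= horner_mx_X horner_mx_C expr2.
split=> cB.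
  have [|_ /(_ x)] := @psdmx_horner _ _ B ('X^2 - c%:P) Bs.
    by move=> a /cB; rewrite !hornerE subr_ge0.
  rewrite hornerE1 -mulmxA -/(dot _ _) mulmxBl mul_scalar_mx.
  by rewrite dotDr dotNr dotZr subr_ge0.
have [|_ /(_ x)] := @psdmx_horner _ _ B (c%:P - 'X^2) Bs.
  by move=> a /cB; rewrite !hornerE subr_ge0.
rewrite hornerE2 -mulmxA -/(dot _ _) mulmxBl mul_scalar_mx.
by rewrite dotDr dotNr dotZr subr_ge0.
Qed.

(** Applied to the spectrum, this keeps [sup] and [inf] away from their default
    values and makes the smallest singular value positive. *)
Lemma seq_bounds (s : seq R) : {in s, forall a, 0 < a} ->
  exists c C, 0 < c /\ {in s, forall a, c <= a <= C}.
Proof.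
elim: s => [|a s IH] s_gt0; first by exists 1, 1.
have [b bs|c [C [c0 cC]]] := IH; first by rewrite s_gt0// inE bs orbT.
have a0 : 0 < a by rewrite s_gt0// mem_head.
exists (Num.min a c), (Num.max a C); rewrite lt_min a0 c0; split=> // b.
rewrite inE => /predU1P[->|/cC /andP[cb bC]]; rewrite ge_min le_max ?lexx//.
by rewrite cb bC !orbT.
Qed.

Lemma singular_value_bounds m n (A : 'M[R]_(m, n.+1)) : \rank A = n.+1 ->
  0 < sigma_min A /\ forall x : 'cV[R]_n.+1,
    sigma_min A ^+ 2 * dot x x <= dot (A *m x) (A *m x)
      <= sigma_max A ^+ 2 * dot x x.
Proof.
move=> rankA; have [Bpsd BB] := sqrtmxP (gram_psd A).
rewrite /sigma_min /sigma_max; set B := sqrtmx _ in Bpsd BB *.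
have [Bs _] := Bpsd; have [s sE [s_neq0 _]] := symmetric_eigenvalues Bs.
have B_gt0 a : eigenvalue B a -> 0 < a.
  move=> aB; rewrite lt0r (psdmx_eigenvalue_ge0 Bpsd aB) andbT.
  apply/eqP => a0; have /eigenvalueP[v vB v0] := aB.
  move: v0; rewrite -trmx_eq0 => /negP; apply.
  have Av : A *m v^T = 0.
    apply/eqP; rewrite -dot_eq0 dot_mull mulmxA -BB -{1 2}Bs -mulmxA -trmx_mul.
    by rewrite vB a0 scale0r trmx0 mulmx0 dot0r.
  have : row_free A^T by rewrite /row_free mxrank_tr rankA.
  rewrite -kermx_eq0 => /rowV0P kerA; apply/eqP; rewrite (kerA v) ?trmx0//.
  by apply/sub_kermxP/trmx_inj; rewrite trmx_mul trmxK Av trmx0.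
have [c [C [c0 cC]]] := @seq_bounds s (fun a sa => B_gt0 a (etrans (sE a) sa)).
set E := [set a | eigenvalue B a].
have E0 : E !=set0.
  by case: (s) sE s_neq0 => // a s' sE _; exists a; rewrite /E/= sE mem_head.
have Ec a : eigenvalue B a -> inf E <= a.
  move=> aB; apply: ge_inf => //; exists c => b.
  by rewrite /E/= sE => /cC/andP[].
have EC a : eigenvalue B a -> a <= sup E.
  move=> aB; apply: sup_upper_bound => //; split=> //; exists C => b.
  by rewrite /E/= sE => /cC/andP[].
have inf_gt0 : 0 < inf E.
  apply: lt_le_trans c0 _; apply: lb_le_inf => // b.
  by rewrite /E/= sE => /cC/andP[].
split=> // x; have -> : dot (A *m x) (A *m x) = dot x (B *m B *m x).
  by rewrite BB dot_mull mulmxA.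
apply/andP; split.
  apply: (sqr_psd_bounds _ _ Bs).1.
  by move=> a aB; rewrite ler_sqr ?Ec// nnegrE ltW// B_gt0.
apply: (sqr_psd_bounds _ _ Bs).2 => a aB; rewrite ler_sqr ?EC// nnegrE.
  by rewrite ltW// B_gt0.
by rewrite (le_trans _ (EC _ aB))// ltW// B_gt0.
Qed.

(** [A] and its transpose have the same operator norm; with [y' := A^T y] this is
    the nonnegativity of [|c y - A y'|^2]. *)
Lemma dot_trmx_le m n (A : 'M[R]_(m, n)) c : 0 < c ->
  (forall x : 'cV[R]_n, dot (A *m x) (A *m x) <= c * dot x x) ->
  forall y : 'cV[R]_m, dot (A^T *m y) (A^T *m y) <= c * dot y y.
Proof.
move=> c0 Ac y; have := dot_ge0 (c *: y - A *m (A^T *m y)).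
rewrite dotDl !dotDr !dotNl !dotNr !dotZl !dotZr.
rewrite (dotC (A *m _) y).
rewrite (_ : dot y (A *m (A^T *m y)) = dot (A^T *m y) (A^T *m y)) => [H|].
  have := Ac (A^T *m y); set t := dot (A^T *m y) _ in H *.
  set u := dot (A *m _) _ in H *; set w := dot y y in H * => uc.
  rewrite -(ler_pM2l c0); lra.
by rewrite [RHS]dot_mull trmxK.
Qed.

Lemma sigma_kappa2_bounds m n (A : 'M[R]_(m, n.+1)) : \rank A = n.+1 ->
  [/\ 0 < sigma_min A ^+ 2, 0 < sigma_max A ^+ 2 & 1 <= kappa2 A].
Proof.
move=> rankA; have [s0 sA] := singular_value_bounds rankA.
have smin : 0 < sigma_min A ^+ 2 by rewrite exprn_gt0.
have le : sigma_min A ^+ 2 <= sigma_max A ^+ 2.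
  have := sA (const_mx 1).
  have : 0 < dot (const_mx 1 : 'cV[R]_n.+1) (const_mx 1).
    rewrite lt0r dot_ge0 andbT dot_eq0; apply/eqP => /colP/(_ 0)/eqP.
    by rewrite !mxE oner_eq0.
  by move=> d0 /andP[h1 h2]; have := le_trans h1 h2; rewrite ler_pM2r.
split=> //; first exact: lt_le_trans le.
by rewrite /kappa2 ler_pdivlMr// mul1r.
Qed.

End SingularValues.

(** * The error recursion *)

Section Iteration.
Context {R : realType} (m n s : nat) (A : 'M[R]_(m, n)).

Definition sketch_rows (S : 'M[R]_(m, s)) (J : seq 'I_s) : seq 'cV[R]_n :=
  [seq A^T *m col j S | j <- J].

Fixpoint bgk_error (S : nat -> 'M[R]_(m, s)) (z : 'cV[R]_n) (k : nat) :=
  if k is k'.+1 then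
    orthoproj (sketch_rows (S k') (enum 'I_s)) *m bgk_error S z k'
  else z.

(** The rows of [S^T A] are the vectors [A^T g] for the columns [g] of [S], so one
    Kaczmarz step amounts to deflating along them in succession. *)
Lemma sketch_projE (S : 'M[R]_(m, s)) :
  1%:M - pinvmp (S^T *m A) *m (S^T *m A) =
  orthoproj (sketch_rows S (enum 'I_s)).
Proof.
have [Qs _] := orthoprojP (sketch_rows S (enum 'I_s)).
have rowE_ j : (A^T *m col j S)^T = row j (S^T *m A).
  by rewrite trmx_mul trmxK tr_col -row_mul.
apply: pinvmp_proj => //.
  apply/row_matrixP => j; rewrite row_mul row0 -rowE_ -Qs -trmx_mul.
  by rewrite orthoproj_ker ?trmx0//; apply/map_f; rewrite mem_enum.
by apply: orthoproj_sub => _ /mapP[j _ ->]; rewrite rowE_ row_sub.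
Qed.

Lemma bgk_errorE b xstar x0 (S : nat -> 'M[R]_(m, s)) k : A *m xstar = b ->
  bgk A b S x0 k - xstar = bgk_error S (x0 - xstar) k.
Proof.
move=> Ax; elim: k => [//|k IH] /=.
rewrite -sketch_projE -IH mulmxBr -addrA; congr (_ + _).
by rewrite mulmxBl mul1mx opprB -Ax !mulmxA.
Qed.

End Iteration.

(** * Reciprocals, and the symmetry of the normal law *)

Section MeasurableExtra.
Context d (T : measurableType d) (R : realType).

(** Inversion is continuous away from [0], and a single point does not affect
    measurability. *)
Lemma measurable_funV (f : T -> R) :
  measurable_fun setT f -> measurable_fun setT (fun x => (f x)^-1).
Proof.
move=> mf; apply: (@measurableT_comp _ _ _ _ _ _ (fun x : R => x^-1)) => //.
rewrite -(setvU [set (0 : R)]).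
apply/measurable_funU; [exact: measurableC|by []|split].
- apply: open_continuous_measurable_fun; first exact/closed_openC/closed_eq.
  by move=> x; rewrite inE/= => /eqP x0; exact: inv_continuous.
- exact: measurable_fun_set1.
Qed.

End MeasurableExtra.

Section NormalSymmetry.
Context {R : realType}.

Lemma normal_probN (B : set R) : measurable B ->
  normal_prob (0 : R) 1 (-%R @^-1` B) = normal_prob 0 1 B.
Proof.
move=> mB; rewrite /normal_prob.
under [LHS]eq_integral.
  move=> x _; rewrite (_ : normal_pdf 0 1 x = normal_pdf 0 1 (- x)); last first.
    by rewrite normal_pdfE// /normal_fun !subr0 sqrrN.
over.
rewrite -(@ge0_integral_pushforward _ _ _ _ _
  (-%R : measurableTypeR R -> measurableTypeR R) _ lebesgue_measure B
  (fun x => (normal_pdf 0 1 x)%:E))//.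
all: try exact: measurable_realfun.oppr_measurable.
- by apply: eq_measure_integral => //= A mA AS; exact: lebesgue_measureN.
- apply: measurable_funTS; apply/measurable_EFinP.
  exact: measurable_normal_pdf.
- by move=> x _; rewrite lee_fin normal_pdf_ge0.
Qed.

Lemma normal_prob_set1 (a : R) : normal_prob (0 : R) 1 [set a] = 0%E.
Proof. by rewrite /normal_prob integral_set1. Qed.

End NormalSymmetry.

(** * Laws of families of independent coordinates *)

Section ProductSpace.
Context {R : realType} {I : choiceType}.

Definition box (J : seq I) (B : I -> set R) : set (I -> R) :=
  [set e | forall i, i \in J -> B i (e i)].

Definition boxes : set (set (I -> R)) :=
  [set C | exists J B, [/\ uniq J, forall i, measurable (B i) & C = box J B]].

(** The product space [R^I] with its cylinder sigma-algebra. *)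
Definition coords := g_sigma_algebraType boxes.

Lemma boxesI : setI_closed boxes.
Proof.
move=> _ _ [J [B [uJ mB ->]]] [J' [B' [uJ' mB' ->]]].
pose D i := (if i \in J then B i else setT) `&`
  (if i \in J' then B' i else setT).
exists (undup (J ++ J')), D; split; first exact: undup_uniq.
  by move=> i; apply: measurableI; case: ifP.
apply/seteqP; split=> e /=.
  move=> [eB eB'] i _; rewrite /D; split; first by case: ifP => // /eB.
  by case: ifP => // /eB'.
move=> eD; split=> i iJ; have := eD i; rewrite mem_undup mem_cat iJ ?orbT /D iJ.
  by move=> /(_ isT)[].
by move=> /(_ isT)[].
Qed.

Lemma measurable_coord (i : I) : measurable_fun setT (fun e : coords => e i).
Proof.
move=> _ B mB; rewrite setTI; apply: sub_sigma_algebra.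
exists [:: i], (fun=> B); split=> //; apply/seteqP; split=> e /=.
  by move=> Bei j; rewrite inE => /eqP ->.
by apply; rewrite mem_head.
Qed.

Lemma measurable_fun_coords d (T : measurableType d) (f : T -> coords) :
  (forall i, measurable_fun setT (fun w => f w i)) -> measurable_fun setT f.
Proof.
move=> mf; apply: (@measurability _ _ T coords setT f boxes erefl).
move=> _ [_ [J [B [uJ mB ->]]] <-].
rewrite (_ : f @^-1` _ = \big[setI/setT]_(i <- J) (fun w => f w i) @^-1` B i).
  rewrite setTI; apply: bigsetI_measurable => i _.
  rewrite -[X in measurable X]setTI.
  by apply: mf => //; exact: mB.
apply/seteqP; split=> e; rewrite -bigcap_seq; [|move=> + i iJ]; exact.
Qed.

(** By uniqueness of measures that agree on cylinders, this determines [mu] as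
    the product of copies of [nu]. *)
Definition product_law (nu : set R -> \bar R) (mu : set coords -> \bar R) :=
  forall J B, uniq J -> (forall i, measurable (B i)) ->
    mu (box J B) = (\prod_(i <- J) nu (B i))%E.

Lemma boxes_unique (m1 m2 : {measure set coords -> \bar R}) :
  (m1 setT < +oo)%E -> (forall C, boxes C -> m1 C = m2 C) ->
  forall C, measurable C -> m1 C = m2 C.
Proof.
move=> m1T m12.
apply: (@measure_unique _ R coords boxes (fun=> setT)
  erefl boxesI _ _ m1 m2) => //.
  by move=> _; exists [::], (fun=> setT); split=> //; apply/seteqP; split.
by apply/seteqP; split => // x _; exists 0%N.
Qed.

(** A law of independent coordinates is invariant under relabelling the
    coordinates and under coordinatewise maps that preserve [nu]: the image law
    takes the same values on boxes. Sign changes of one coordinate and exchanges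
    of two coordinates are the instances needed below, and they replace any
    conditioning. *)
Section Symmetry.
Variables (nu : set R -> \bar R) (mu : probability coords R).
Hypothesis mu_law : product_law nu mu.
Variables (sigma : I -> I) (h : I -> R -> R).
Hypothesis sigmaK : involutive sigma.
Hypothesis mh : forall i, measurable_fun setT (h i).
Hypothesis nuh : forall i B, measurable B -> nu (h i @^-1` B) = nu B.

Let tau (e : coords) : coords := fun i => h i (e (sigma i)).

Let mtau : measurable_fun setT tau.
Proof.
apply: measurable_fun_coords => i; apply: measurableT_comp => //.
exact: measurable_coord.
Qed.

Lemma product_law_sym C : measurable C -> pushforward mu tau C = mu C.
Proof.
move=> mC; apply/esym; apply: (@boxes_unique mu (pushforward mu tau)) => //.
  by rewrite [X in (X < _)%E](probability_setT mu) ltry.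
move=> _ [J [B [uJ mB ->]]]; apply: (etrans (mu_law uJ mB)); rewrite /pushforward.
apply/esym.
transitivity (mu (box (map sigma J) (fun i => h (sigma i) @^-1` B (sigma i)))).
  congr (mu _); apply/seteqP; split=> e /= eB i.
    by move=> /mapP[j jJ ->]; rewrite sigmaK; exact: eB.
  by move=> iJ; have := eB _ (map_f sigma iJ); rewrite sigmaK.
apply: etrans (mu_law _ _) _.
- by rewrite map_inj_uniq//; exact: inv_inj.
- by move=> i; rewrite -[X in measurable X]setTI; apply: mh => //; exact: mB.
by rewrite big_map; apply: eq_bigr => i _; rewrite sigmaK nuh//; exact: mB.
Qed.

Lemma integral_sym (f : coords -> R) : measurable_fun setT f ->
  mu.-integrable setT (EFin \o (f \o tau)) ->
  (\int[mu]_e f (tau e) = \int[mu]_e f e)%R.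
Proof.
move=> mf intf; rewrite /Rintegral; congr fine.
rewrite -[LHS](@integral_pushforward _ _ _ _ _ tau mtau mu setT (EFin \o f))//.
  by apply: eq_measure_integral => C mC _; exact: product_law_sym.
exact/measurable_EFinP.
Qed.

End Symmetry.

End ProductSpace.

Section Atomless.
Context {R : realType} {I : choiceType}.
Variables (nu : probability (measurableTypeR R) R).
Variables (mu : probability (@coords R I) R).
Hypothesis mu_law : product_law nu mu.
Hypothesis nu_atomless : forall a, nu [set a] = 0%E.

Let erase (i : I) (e : @coords R I) : @coords R I :=
  fun j => if j == i then 0 else e j.

Let measurable_erase i : measurable_fun setT (erase i).
Proof.
apply: measurable_fun_coords => j; rewrite /erase; case: eqP => _ //.
exact: measurable_coord.
Qed.

(** Independence of one coordinate from the collection of all others, which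
    [erase i] retains. For fixed [A] both sides are finite measures in [C], and
    they agree on boxes by the product formula. *)
Lemma product_law_indep i (A : set R) (C : set coords) :
  measurable A -> measurable C ->
  mu (erase i @^-1` C `&` [set e | A (e i)]) = (mu (erase i @^-1` C) * nu A)%E.
Proof.
move=> mA mC; have me := measurable_erase i.
have mAi : measurable ([set e | A (e i)] : set (@coords R I)).
  by rewrite -[X in measurable X]setTI; exact: measurable_coord.
have nuA : nu A \is a fin_num by exact: fin_num_measure.
pose c : {nonneg R} := NngNum (fine_ge0 (measure_ge0 nu A)).
pose m1 := pushforward (mrestr mu mAi) (erase i).
pose U : {mfun (@coords R I) >-> (@coords R I)} :=
  HB.pack (erase i) (isMeasurableFun.Build _ _ _ _ _ me).
pose m2 := distribution mu U.
suff m12 : m1 C = mscale c m2 C.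
  move: m12; rewrite /m1 /m2 /distribution /mscale /pushforward /mrestr /= fineK//.
  by move=> ->; rewrite muleC.
apply: (@boxes_unique R I m1 (mscale c m2)) => //.
  rewrite /m1 /pushforward /mrestr; apply: (le_lt_trans (probability_le1 _ _)).
    by apply: measurableI => //; rewrite preimage_setT.
  by rewrite ltry.
move=> {C mC} _ [J [B [uJ mB ->]]].
change (mu (erase i @^-1` box J B `&` [set e | A (e i)]) =
  (fine (nu A))%:E * mu (erase i @^-1` box J B))%E.
rewrite fineK//.
(* Erased families have [i]-th coordinate [0], so a constraint on it is either
   impossible or vacuous. *)
have [Bi|nBi] := pselect (i \in J -> B i 0); last first.
  have -> : erase i @^-1` box J B = set0 :> set (@coords R I).
    apply/seteqP; split=> // e /= eB; apply: nBi => iJ.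
    by have := eB i iJ; rewrite /erase eqxx.
  by rewrite set0I !measure0 mule0.
have -> : erase i @^-1` box J B = box [seq j <- J | j != i] B.
  apply/seteqP; split=> e /= eB j.
    by rewrite mem_filter /= => /andP[ji /eB]; rewrite /erase (negbTE ji).
  rewrite /erase; case: eqP => [->//|/eqP ji jJ].
  by apply: eB; rewrite mem_filter /= ji.
pose B' j := if j == i then A else B j.
have -> : box [seq j <- J | j != i] B `&` [set e | A (e i)] =
    box (i :: [seq j <- J | j != i]) B'.
  apply/seteqP; split=> e /=.
    move=> [eB eA] j; rewrite /B' inE.
    case: eqP => [->//|/eqP ji /=]; exact: eB.
  move=> eB; split=> [j jJ|]; last first.
    by have := eB i (mem_head _ _); rewrite /B' eqxx.
  have := eB j; rewrite inE jJ orbT /B' => /(_ isT).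
  by move: jJ; rewrite mem_filter /= => /andP[/negbTE->].
have uJ' : uniq [seq j <- J | j != i] by rewrite filter_uniq.
rewrite !mu_law//; last 2 first.
- by rewrite /= uJ' mem_filter /= eqxx.
- by move=> j; rewrite /B'; case: ifP.
rewrite big_cons /B' eqxx; congr (_ * _)%E; apply: eq_big_seq => j.
by rewrite mem_filter /= => /andP[/negbTE->].
Qed.

(** The pair ([y], coordinate [i]) has a product law whose second factor has no
    atoms, and such a law does not charge the diagonal. *)
Lemma coord_neq i (y : coords -> R) : measurable_fun setT y ->
  (forall e e', (forall j, j != i -> e j = e' j) -> y e = y e') ->
  mu [set e | e i = y e] = 0%E.
Proof.
move=> my yE; have me := measurable_erase i.
have ye e : y e = y (erase i e) by apply: yE => j ji; rewrite /erase (negbTE ji).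
have my' : @measurable_fun _ _ (@coords R I) (measurableTypeR R) setT y.
  exact: my.
pose Y : {mfun (@coords R I) >-> measurableTypeR R} :=
  HB.pack (y : (@coords R I) -> measurableTypeR R)
    (isMeasurableFun.Build _ _ _ _ _ my').
pose pr (e : @coords R I) : (measurableTypeR R * measurableTypeR R)%type :=
  (y e, e i).
have mpr : measurable_fun setT pr.
  by apply: measurable_fun_pair => //; exact: measurable_coord.
pose D : set (measurableTypeR R * measurableTypeR R) :=
  [set p | p.1 - p.2 = 0 :> R].
have mD : measurable D.
  rewrite -[X in measurable X]setTI.
  have msub : measurable_fun setT
      (fun p : measurableTypeR R * measurableTypeR R => p.1 - p.2 : R).
    by apply: measurable_funB; [exact: measurable_fst|exact: measurable_snd].
  exact: (msub _ _ (measurable_set1 (0 : R))).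
have DE : (distribution mu Y \x nu)%E D = pushforward mu pr D.
  apply: (@product_measure_unique _ _ _ _ _ (distribution mu Y) nu
    (pushforward mu pr)) => //.
  move=> A B mA mB; rewrite /pushforward.
  transitivity (mu (erase i @^-1` (y @^-1` A) `&` [set e | B (e i)])).
    by congr (mu _); apply/seteqP; split=> e; rewrite /pr /= -ye.
  rewrite (@product_law_indep i B (y @^-1` A))//; last first.
    by rewrite -[X in measurable X]setTI; exact: my.
  rewrite /distribution /pushforward /=; congr (mu _ * _)%E.
  by apply/seteqP; split=> e /=; rewrite -ye.
transitivity (pushforward mu pr D).
  congr (mu _); apply/seteqP; split=> e /=; rewrite /D /=.
    by move->; rewrite subrr.
  by move/eqP; rewrite subr_eq0 => /eqP.
rewrite -DE /= /product_measure1 integral0_eq// => x _.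
rewrite /= (_ : xsection D x = [set x])//.
apply/seteqP; split=> z; rewrite /xsection /= inE /D /=.
  by move/eqP; rewrite subr_eq0 => /eqP ->.
by move=> ->; rewrite subrr.
Qed.

End Atomless.

(** * Integrals of bounded measurable functions *)

Section BoundedMeasurable.
Context d (T : measurableType d) (R : realType) (mu : probability T R).
Implicit Types f g : T -> R.

Definition bounded_measurable f :=
  measurable_fun setT f /\ exists M, forall x, `|f x| <= M.

Lemma bounded_measurable_integrable f : bounded_measurable f ->
  mu.-integrable setT (EFin \o f).
Proof.
move=> [mf [M fM]]; apply: measurable_bounded_integrable => //.
  by rewrite [X in (X < _)%E](probability_setT mu) ltry.
exists M; split; first exact: num_real.
by move=> x Mx y _; rewrite /= (le_trans (fM y))// ltW.
Qed.

Lemma bounded_measurableM f g : bounded_measurable f -> bounded_measurable g ->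
  bounded_measurable (fun x => f x * g x).
Proof.
move=> [mf [M fM]] [mg [N gN]]; split; first exact: measurable_funM.
by exists (M * N) => x; rewrite normrM ler_pM.
Qed.

Lemma bounded_measurable_sum (J : Type) (s : seq J) (f : J -> T -> R) :
  (forall j, bounded_measurable (f j)) ->
  bounded_measurable (fun x => \sum_(j <- s) f j x).
Proof.
move=> bf; split; first by apply: measurable_sum => j; case: (bf j).
elim: s => [|j s [M IH]]; first by exists 0 => x; rewrite big_nil normr0.
have [_ [N fN]] := bf j; exists (N + M) => x.
by rewrite big_cons (le_trans (ler_normD _ _))// lerD.
Qed.

Lemma Rintegral_sum (J : Type) (s : seq J) (f : J -> T -> R) :
  (forall j, bounded_measurable (f j)) ->
  (\int[mu]_x (\sum_(j <- s) f j x) = \sum_(j <- s) \int[mu]_x f j x)%R.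
Proof.
move=> bf; elim: s => [|j s IH].
  rewrite big_nil /Rintegral; under eq_integral do rewrite big_nil.
  by rewrite integral0.
rewrite big_cons -IH -RintegralD//.
- by apply: eq_Rintegral => x _; rewrite big_cons.
- exact: bounded_measurable_integrable.
- by apply: bounded_measurable_integrable; exact: bounded_measurable_sum.
Qed.

Lemma ae_eq_Rintegral f g : measurable_fun setT f -> measurable_fun setT g ->
  {ae mu, forall x, f x = g x} -> (\int[mu]_x f x = \int[mu]_x g x)%R.
Proof.
move=> mf mg fg; rewrite /Rintegral; congr fine; apply: ae_eq_integral => //.
- exact/measurable_EFinP.
- exact/measurable_EFinP.
- by apply: filterS fg => x /= -> _.
Qed.

End BoundedMeasurable.

(** * The direction of an exchangeable symmetric vector *)

Section Isotropy.
Context {R : realType} {I : choiceType}.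
Variables (nu : probability (measurableTypeR R) R).
Variables (mu : probability (@coords R I) R).
Hypothesis mu_law : product_law nu mu.
Hypothesis nu_atomless : forall a, nu [set a] = 0%E.
Hypothesis nu_sym : forall B : set R, measurable B -> nu (-%R @^-1` B) = nu B.
Variables (m : nat) (c : 'I_m -> I).
Hypothesis c_inj : injective c.

(** Plays the role of independence from the coordinates in the range of [c]. *)
Definition ignores (V : Type) (f : @coords R I -> V) :=
  forall e e', (forall j, (forall l, j != c l) -> e j = e' j) -> f e = f e'.

Let D (e : @coords R I) := \sum_l e (c l) ^+ 2.

Let D_ge0 e : 0 <= D e.
Proof. by apply: sumr_ge0 => l _; rewrite sqr_ge0. Qed.

Let coord_sqr_le e l : e (c l) ^+ 2 <= D e.
Proof.
rewrite /D (bigD1 l)//= lerDl; apply: sumr_ge0 => i _; exact: sqr_ge0.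
Qed.

Let q (l l' : 'I_m) (e : @coords R I) := e (c l) * e (c l') / D e.

Let q_bm l l' : bounded_measurable (q l l').
Proof.
split.
  apply: measurable_funM.
    by apply: measurable_funM; exact: measurable_coord.
  apply: measurable_funV; apply: measurable_sum => k.
  by apply: measurable_funX; exact: measurable_coord.
exists 1 => e; rewrite normrM normfV (ger0_norm (D_ge0 e)).
have [->|D0] := eqVneq (D e) 0; first by rewrite invr0 mulr0.
rewrite ler_pdivrMr ?lt0r ?D0 ?D_ge0// mul1r.
have := coord_sqr_le e l; have := coord_sqr_le e l'; have := D_ge0 e.
rewrite normrM -(real_normK (num_real (e (c l)))).
rewrite -(real_normK (num_real (e (c l')))).
move: `|e (c l)| `|e (c l')| (D e) => a b t; nra.
Qed.

(** If [g] is the vector of the coordinates [c l], then [g / |g|] has second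
    moment matrix [Id / m], even after weighting by functions that ignore [g]. Changing the sign
    of one coordinate of [g] kills the off-diagonal terms; exchanging two
    coordinates makes the diagonal terms equal, and they sum to one because [g]
    is almost surely nonzero. *)
Lemma mean_sqr_direction (u : 'I_m -> @coords R I -> R) :
  (forall l, bounded_measurable (u l)) -> (forall l, ignores (u l)) ->
  (\int[mu]_e (m%:R * ((\sum_l e (c l) * u l e) ^+ 2 / D e)) =
   \int[mu]_e (\sum_l u l e ^+ 2))%R.
Proof.
move=> u_bm u_ind.
pose w l l' e := u l e * u l' e * q l l' e.
have w_bm l l' : bounded_measurable (w l l').
  by apply: bounded_measurableM => //; exact: bounded_measurableM.
have w_off l l' : l != l' -> (\int[mu]_e w l l' e = 0)%R.
  move=> ll'; pose h i := if i == c l then (-%R : R -> R) else id.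
  have mh i : measurable_fun setT (h i).
    by rewrite /h; case: eqP => _ //; exact: measurable_realfun.oppr_measurable.
  have nuh i (B : set R) : measurable B -> nu (h i @^-1` B) = nu B.
    by rewrite /h; case: eqP => _ //; exact: nu_sym.
  have wN e : w l l' (fun i => h i (e i)) = - w l l' e.
    have hu k : u k (fun i => h i (e i)) = u k e.
      by apply: u_ind => j jc; rewrite /h (negbTE (jc l)).
    have hD : D (fun i => h i (e i)) = D e.
      by apply: eq_bigr => k _; rewrite /h; case: eqP => _ //; rewrite sqrrN.
    rewrite /w !hu /q hD {1 2}/h eqxx (inj_eq c_inj) eq_sym (negbTE ll').
    by rewrite !mulNr mulrN.
  have w_int := bounded_measurable_integrable mu (w_bm l l').
  have := @integral_sym R I nu mu mu_law id h (fun=> erefl) mh nuh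
    (w l l') (w_bm l l').1.
  rewrite (_ : _ \o _ = (fun e => - 1 * w l l' e)); last first.
    by apply/funext => e /=; rewrite wN mulN1r.
  have -> : (\int[mu]_e w l l' (fun i => h i (e i)) = - \int[mu]_e w l l' e)%R.
    under eq_Rintegral do rewrite wN -mulN1r.
    by rewrite RintegralZl// mulN1r.
  move=> /(_ _)/eqP; rewrite eq_sym -subr_eq0 opprK -mulr2n mulrn_eq0/=.
  move=> H; apply/eqP/H; apply: bounded_measurable_integrable.
  by apply: bounded_measurableM => //; split=> //; exists 1 => e; rewrite normrN1.
have w_diag l l' : (\int[mu]_e (u l e ^+ 2 * q l l e) =
    \int[mu]_e (u l e ^+ 2 * q l' l' e))%R.
  pose sg i := if i == c l then c l' else if i == c l' then c l else i.
  have sgc k : sg (c k) = c (tperm l l' k).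
    rewrite /sg !(inj_eq c_inj); case: tpermP => [->|->|]; rewrite ?eqxx//.
      by case: eqP => // ->.
    by move=> /eqP/negbTE-> /eqP/negbTE->.
  have sgK : involutive sg.
    move=> i; rewrite {2}/sg; case: eqP => [->|il]; first by rewrite sgc tpermR.
    case: eqP => [->|il']; first by rewrite sgc tpermL.
    by rewrite /sg; case: eqP => // _; case: eqP.
  pose f e := u l e ^+ 2 * q l l e.
  have f_bm : bounded_measurable f.
    by apply: bounded_measurableM => //; exact: bounded_measurableM.
  have fE e : f (fun i => e (sg i)) = u l e ^+ 2 * q l' l' e.
    rewrite /f /q sgc tpermL (u_ind l _ e) => [|j jc]; last first.
      by rewrite /sg !(negbTE (jc _)).
    congr (_ * (_ / _)); rewrite [RHS](reindex_inj (@perm_inj _ (tperm l l'))).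
    by apply: eq_bigr => k _; rewrite sgc.
  rewrite -(@integral_sym R I nu mu mu_law sg (fun=> id) sgK _ _ f f_bm.1)//.
    by apply: eq_Rintegral => e _; rewrite fE.
  apply: bounded_measurable_integrable.
  rewrite (_ : _ \o _ = fun e => u l e ^+ 2 * q l' l' e); last exact/funext.
  by apply: bounded_measurableM => //; exact: bounded_measurableM.
have D_neq0 : (0 < m)%N -> {ae mu, forall e, D e != 0}.
  move=> m0; pose l0 := Ordinal m0.
  have mu0 : mu [set e | e (c l0) = 0] = 0%E.
    by apply: (@coord_neq R I nu mu mu_law nu_atomless _ (fun=> 0)).
  exists [set e | e (c l0) = 0]; split => //.
    rewrite -[X in measurable X]setTI.
    exact: (measurable_coord _ _ (measurable_set1 0)).
  move=> e /= /negP; rewrite negbK => /eqP De0; apply/eqP; rewrite -sqrf_eq0.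
  by rewrite eq_le sqr_ge0 andbT -De0.
have diag l : m%:R * (\int[mu]_e w l l e)%R = (\int[mu]_e (u l e ^+ 2))%R.
  have m0 : (0 < m)%N by exact: leq_ltn_trans (ltn_ord l).
  have q_sum_bm l' : bounded_measurable (fun e => u l e ^+ 2 * q l' l' e).
    by apply: bounded_measurableM => //; exact: bounded_measurableM.
  transitivity (\sum_(l' < m) \int[mu]_e (u l e ^+ 2 * q l' l' e))%R.
    rewrite (eq_bigr (fun=> \int[mu]_e w l l e)%R) => [|l' _].
      by rewrite sumr_const card_ord mulr_natl.
    by rewrite -w_diag; apply: eq_Rintegral => e _; rewrite expr2.
  rewrite -Rintegral_sum//; apply: ae_eq_Rintegral.
  - exact: (bounded_measurable_sum _ q_sum_bm).1.
  - by apply: measurable_funX; exact: (u_bm l).1.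
  apply: filterS (D_neq0 m0) => e De.
  rewrite -mulr_sumr; under eq_bigr do rewrite /q -expr2.
  by rewrite -mulr_suml divff ?mulr1.
have sqE e : (\sum_l e (c l) * u l e) ^+ 2 / D e = \sum_l \sum_l' w l l' e.
  rewrite expr2 mulr_suml mulr_suml; apply: eq_bigr => l _.
  rewrite mulr_sumr mulr_suml; apply: eq_bigr => l' _.
  by rewrite /w /q [RHS]mulrA; congr (_ / _); rewrite mulrACA [LHS]mulrC.
under eq_Rintegral do rewrite sqE.
have row_bm l : bounded_measurable (fun e => \sum_l' w l l' e).
  exact: bounded_measurable_sum.
rewrite RintegralZl//; last first.
  by apply: bounded_measurable_integrable; exact: bounded_measurable_sum.
rewrite !Rintegral_sum//; last by move=> l; exact: bounded_measurableM.
rewrite mulr_sumr; apply: eq_bigr => l _; rewrite -diag; congr (_ * _).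
rewrite Rintegral_sum// (bigD1 l)//= big1 ?addr0// => l' l'l.
by rewrite w_off// eq_sym.
Qed.

End Isotropy.

(** * Measurability of matrix-valued functions *)

Section MeasurableMatrix.
Context d (T : measurableType d) (R : realType).

Definition measurable_mx p q (F : T -> 'M[R]_(p, q)) :=
  forall i j, measurable_fun setT (fun w => F w i j).

Lemma measurable_mx_cst p q (B : 'M[R]_(p, q)) : measurable_mx (fun=> B).
Proof. by move=> i j; exact: measurable_cst. Qed.

Lemma measurable_mx_mul p q r (F : T -> 'M[R]_(p, q)) (G : T -> 'M[R]_(q, r)) :
  measurable_mx F -> measurable_mx G -> measurable_mx (fun w => F w *m G w).
Proof.
move=> mF mG i j; under eq_fun do rewrite mxE.
by apply: measurable_sum => k; exact: measurable_funM.
Qed.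

Lemma measurable_dot p (x y : T -> 'cV[R]_p) :
  measurable_mx x -> measurable_mx y ->
  measurable_fun setT (fun w => dot (x w) (y w)).
Proof.
move=> mx my; under eq_fun do rewrite dotE.
by apply: measurable_sum => k; exact: measurable_funM.
Qed.

Lemma deflateE p (Q : 'M[R]_p) (a : 'cV[R]_p) i j : deflate Q a i j =
  Q i j - (dot (Q *m a) (Q *m a))^-1 * ((Q *m a) i 0 * (Q *m a) j 0).
Proof.
rewrite /deflate; move: (Q *m a) => q; rewrite !mxE big_ord1 !mxE.
by [].
Qed.

Lemma measurable_deflate p (Q : T -> 'M[R]_p) (a : T -> 'cV[R]_p) :
  measurable_mx Q -> measurable_mx a ->
  measurable_mx (fun w => deflate (Q w) (a w)).
Proof.
move=> mQ ma i j; have mq := measurable_mx_mul mQ ma.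
under eq_fun do rewrite deflateE.
apply: measurable_funB => //; apply: measurable_funM.
  by apply: measurable_funV; exact: measurable_dot.
by apply: measurable_funM; exact: mq.
Qed.

End MeasurableMatrix.

(** * Mean square error along a sweep *)

Section Kaczmarz.
Context {R : realType}.
Variables (m n s : nat) (A : 'M[R]_(m, n)) (z0 : 'cV[R]_n).
Let Omega := @coords R (nat * 'I_m * 'I_s)%type.

(** The random matrices, read on the canonical space of all their entries. *)
Definition sample_mx (e : Omega) (k : nat) : 'M[R]_(m, s) :=
  \matrix_(i, j) e (k, i, j).

Definition partial_proj k J (e : Omega) : 'M[R]_n :=
  orthoproj (sketch_rows A (sample_mx e k) J).

Definition error_vec k (e : Omega) : 'cV[R]_n := bgk_error A (sample_mx e) z0 k.

Lemma partial_proj_rcons k J j e : partial_proj k (rcons J j) e =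
  deflate (partial_proj k J e) (A^T *m col j (sample_mx e k)).
Proof. by rewrite /partial_proj /sketch_rows map_rcons orthoproj_rcons. Qed.

Lemma partial_proj_nil k e : partial_proj k [::] e = 1%:M.
Proof. by []. Qed.

Lemma error_vecS k e :
  error_vec k.+1 e = partial_proj k (enum 'I_s) e *m error_vec k e.
Proof. by []. Qed.

Lemma measurable_sample_col k j :
  measurable_mx (fun e : Omega => col j (sample_mx e k)).
Proof.
move=> i l.
have -> : (fun e : Omega => col j (sample_mx e k) i l) = (fun e => e (k, i, j)).
  by apply/funext => e; rewrite !mxE.
exact: measurable_coord.
Qed.

Lemma measurable_partial_proj k J : measurable_mx (partial_proj k J).
Proof.
elim/last_ind: J => [|J j IH]; first exact: (measurable_mx_cst 1%:M).
rewrite (_ : partial_proj _ _ = fun e => deflate (partial_proj k J e)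
    (A^T *m col j (sample_mx e k))); last first.
  by apply/funext => e; exact: partial_proj_rcons.
apply: measurable_deflate => //.
exact: (measurable_mx_mul (measurable_mx_cst A^T) (@measurable_sample_col k j)).
Qed.

Lemma measurable_error_vec k : measurable_mx (error_vec k).
Proof.
elim: k => [|k IH]; first exact: (measurable_mx_cst z0).
exact: (measurable_mx_mul (@measurable_partial_proj k _) IH).
Qed.

Definition entry k j (i : 'I_m) : nat * 'I_m * 'I_s := (k, i, j).

Lemma entry_inj k j : injective (entry k j).
Proof. by move=> i i' []. Qed.

Lemma partial_proj_ignores k j k' J : (k' != k) || (j \notin J) ->
  ignores (entry k j) (partial_proj k' J).
Proof.
move=> kj e e' ee'; rewrite /partial_proj; congr orthoproj.
apply/eq_in_map => j' Jj'; congr (_ *m _); apply/colP => i; rewrite !mxE.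
apply: ee' => l; apply/eqP => -[k'k il j'j]; move: kj.
by rewrite k'k eqxx -j'j Jj'.
Qed.

Lemma error_vec_ignores k j k' : (k' <= k)%N ->
  ignores (entry k j) (error_vec k').
Proof.
move=> + e e' ee'; elim: k' => [//|k' IH k'k].
rewrite !error_vecS (@partial_proj_ignores k j k' _ _ e e')//.
  by rewrite IH// ltnW.
by rewrite ltn_eqF.
Qed.

(** The error once the directions in [J] of iteration [k] have been deflated; it
    interpolates between two successive errors. *)
Definition sweep_error k J (e : Omega) := partial_proj k J e *m error_vec k e.

Lemma dot_sweep_le k J e :
  dot (sweep_error k J e) (sweep_error k J e) <=
  dot (error_vec k e) (error_vec k e).
Proof.
rewrite /sweep_error; elim/last_ind: J => [|J j IH].
  by rewrite partial_proj_nil mul1mx.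
rewrite partial_proj_rcons.
have [Qs QQ] := orthoprojP (sketch_rows A (sample_mx e k) J).
by rewrite deflate_norm// (le_trans _ IH)// gerBl divr_ge0 ?sqr_ge0// dot_ge0.
Qed.

Lemma dot_error_vec_le k e : dot (error_vec k e) (error_vec k e) <= dot z0 z0.
Proof.
elim: k => [//|k IH]; rewrite error_vecS; exact: le_trans (dot_sweep_le _ _ _) IH.
Qed.

Lemma sweep_error_ignores k j J : j \notin J -> ignores (entry k j) (sweep_error k J).
Proof.
move=> jJ e e' ee'; rewrite /sweep_error (@error_vec_ignores k j k _ e e')//.
by rewrite (@partial_proj_ignores k j k J _ e e')// jJ orbT.
Qed.

Lemma measurable_sweep_error k J : measurable_mx (sweep_error k J).
Proof.
exact: (measurable_mx_mul (@measurable_partial_proj k J) (@measurable_error_vec k)).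
Qed.

Lemma bounded_measurable_sweep k J :
  bounded_measurable (fun e => dot (sweep_error k J e) (sweep_error k J e)).
Proof.
split; first by apply: measurable_dot; exact: measurable_sweep_error.
exists (dot z0 z0) => e; rewrite ger0_norm ?dot_ge0//.
exact: le_trans (dot_sweep_le _ _ _) (dot_error_vec_le _ _).
Qed.

Variables (nu : probability (measurableTypeR R) R) (mu : probability Omega R).
Hypothesis mu_law : product_law nu mu.
Hypothesis nu_atomless : forall a, nu [set a] = 0%E.
Hypothesis nu_sym : forall B : set R, measurable B -> nu (-%R @^-1` B) = nu B.
Variables (c C : R).
Hypothesis C_gt0 : 0 < C.
Hypothesis A_ge : forall x, c * dot x x <= dot (A *m x) (A *m x).
Hypothesis A_le : forall x, dot (A *m x) (A *m x) <= C * dot x x.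

Definition mean_sq k J := (\int[mu]_e dot (sweep_error k J e) (sweep_error k J e))%R.

(** Pythagoras for the direction [A^T g], in which the length of its deflated part
    is bounded by [|A^T g|^2 <= C |g|^2]. The quotient that remains depends on [g]
    only through its direction. *)
Lemma sweep_error_decrease k J j e (g := col j (sample_mx e k)) :
  dot (sweep_error k (rcons J j) e) (sweep_error k (rcons J j) e) <=
  dot (sweep_error k J e) (sweep_error k J e) -
    C^-1 * (dot g (A *m sweep_error k J e) ^+ 2 / dot g g).
Proof.
rewrite {1 2}/sweep_error partial_proj_rcons -/g.
have [] := orthoprojP (sketch_rows A (sample_mx e k) J).
rewrite -/(partial_proj k J e) => Qs QQ; set a := A^T *m g.
rewrite deflate_norm// -/(sweep_error k J e); set r := sweep_error k J e.
rewrite lerD2l lerN2 mulrCA -invfM.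
have -> : dot g (A *m r) = dot a r by rewrite /a dot_mull trmxK.
set q := _ *m a; have -> : dot a r = dot q r.
  by rewrite /q dot_mull Qs /r /sweep_error (mulmxA _ _ (error_vec k e)) QQ.
have [->|q0] := eqVneq q 0; first by rewrite dotC dot0r expr0n/= !mul0r.
apply: ler_wpM2l; first exact: sqr_ge0.
have qq : 0 < dot q q by rewrite lt0r dot_eq0 q0 dot_ge0.
have qle : dot q q <= C * dot g g.
  exact: le_trans (dot_proj_le _ Qs QQ) (dot_trmx_le C_gt0 A_le g).
rewrite lef_pV2// posrE; exact: lt_le_trans qle.
Qed.

(** The vector [A r], with [r] the current error, ignores the fresh column [g].
    Hence the quotient in [sweep_error_decrease] has mean [E|A r|^2 / m], and
    [|A r|^2 >= c |r|^2]. *)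
Lemma mean_sq_rcons k J j : (0 < m)%N -> j \notin J ->
  mean_sq k (rcons J j) <= (1 - c / (C * m%:R)) * mean_sq k J.
Proof.
move=> m0 jJ; rewrite /mean_sq.
have r_int k' J' :=
  bounded_measurable_integrable mu (bounded_measurable_sweep k' J').
pose u l (e : Omega) := (A *m sweep_error k J e) l 0.
have u_bm l : bounded_measurable (u l).
  split.
    apply: (measurable_mx_mul (measurable_mx_cst A)).
    exact: measurable_sweep_error.
  (* [|t| <= 1 + t^2] turns the bound on the square into a bound. *)
  exists (1 + C * dot z0 z0) => e.
  have ul : u l e ^+ 2 <= C * dot z0 z0.
    apply: (@le_trans _ _ (dot (A *m sweep_error k J e) (A *m sweep_error k J e))).
      rewrite dotE (bigD1 l)//= -expr2 lerDl; apply: sumr_ge0 => i _.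
      by rewrite -expr2 sqr_ge0.
    apply: le_trans (A_le _) _; rewrite ler_pM2l//.
    exact: le_trans (dot_sweep_le _ _ _) (dot_error_vec_le _ _).
  rewrite ler_norml; apply/andP; split; nra.
have u_ind l : ignores (entry k j) (u l).
  by move=> e e' ee'; rewrite /u (sweep_error_ignores jJ ee').
pose g e := col j (sample_mx e k).
pose F e := dot (g e) (A *m sweep_error k J e) ^+ 2 / dot (g e) (g e).
have F_bm : bounded_measurable F.
  split.
    have mg := @measurable_sample_col k j.
    apply: measurable_funM; last by apply: measurable_funV; exact: measurable_dot.
    apply: measurable_funX; apply: measurable_dot => //.
    exact: (measurable_mx_mul (measurable_mx_cst A) (@measurable_sweep_error k J)).
  exists (C * dot z0 z0) => e; rewrite ger0_norm ?divr_ge0 ?sqr_ge0 ?dot_ge0//.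
  rewrite -ler_pdivrMl//.
  have : dot (sweep_error k (rcons J j) e) (sweep_error k (rcons J j) e) <=
      dot (sweep_error k J e) (sweep_error k J e) - C^-1 * F e.
    exact: sweep_error_decrease.
  have := dot_ge0 (sweep_error k (rcons J j) e).
  have := le_trans (dot_sweep_le k J e) (dot_error_vec_le k e).
  lra.
have F_int := bounded_measurable_integrable mu F_bm.
have FAr : m%:R * (\int[mu]_e F e)%R =
    (\int[mu]_e dot (A *m sweep_error k J e) (A *m sweep_error k J e))%R.
  have := mean_sqr_direction mu_law nu_atomless nu_sym (@entry_inj k j)
    u_bm u_ind.
  rewrite -RintegralZl// => iso.
  transitivity (\int[mu]_e \sum_l u l e ^+ 2)%R.
    rewrite -iso; apply: eq_Rintegral => e _; congr (_ * _).
    rewrite /F !dotE; congr (_ ^+ 2 / _); apply: eq_bigr => l _.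
      by congr (_ * _); rewrite !mxE.
    by rewrite !mxE -expr2.
  apply: eq_Rintegral => e _; rewrite dotE.
  by apply: eq_bigr => l _; rewrite expr2.
have c_le : c * (\int[mu]_e dot (sweep_error k J e) (sweep_error k J e))%R <=
    m%:R * (\int[mu]_e F e)%R.
  rewrite FAr -RintegralZl//; apply: le_Rintegral => //.
  - apply: bounded_measurable_integrable.
    apply: bounded_measurableM; last exact: bounded_measurable_sweep.
    by split=> //; exists `|c|.
  - apply: bounded_measurable_integrable; split.
      apply: measurable_dot;
      exact: (measurable_mx_mul (measurable_mx_cst A) (@measurable_sweep_error k J)).
    exists (C * dot z0 z0) => e; rewrite ger0_norm ?dot_ge0//.
    apply: le_trans (A_le _) _; rewrite ler_pM2l//.
    exact: le_trans (dot_sweep_le _ _ _) (dot_error_vec_le _ _).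
apply: (@le_trans _ _
  (\int[mu]_e (dot (sweep_error k J e) (sweep_error k J e) - C^-1 * F e))%R).
  apply: le_Rintegral => //; last first.
    by move=> e _; exact: sweep_error_decrease.
  apply: bounded_measurable_integrable; split.
    apply: measurable_funB; first exact: (bounded_measurable_sweep k J).1.
    by apply: measurable_funM => //; exact: F_bm.1.
  have [_ [M FM]] := F_bm; have [_ [N rN]] := bounded_measurable_sweep k J.
  exists (N + C^-1 * M) => e; rewrite (le_trans (ler_normB _ _))// lerD//.
  have C0 : 0 <= C^-1 by rewrite invr_ge0 ltW.
  by rewrite normrM (ger0_norm C0) ler_wpM2l.
rewrite RintegralB//; last first.
  apply: bounded_measurable_integrable.
  by apply: bounded_measurableM => //; split=> //; exists `|C^-1|.
rewrite RintegralZl// mulrBl mul1r lerD2l lerN2.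
move: c_le; set X := (\int[mu]_e dot _ _)%R; set Y := (\int[mu]_e F e)%R => XY.
have -> : c / (C * m%:R) * X = C^-1 * (m%:R^-1 * (c * X)) by rewrite invfM; ring.
by rewrite ler_wpM2l ?invr_ge0 ?(ltW C_gt0)// ler_pdivrMl ?ltr0n.
Qed.

Lemma mean_sq_uniq k J : (0 < m)%N -> 0 <= 1 - c / (C * m%:R) -> uniq J ->
  mean_sq k J <= (1 - c / (C * m%:R)) ^+ size J * mean_sq k [::].
Proof.
move=> m0 r0; elim/last_ind: J => [|J j IH]; first by rewrite mul1r.
rewrite rcons_uniq => /andP[jJ uJ]; rewrite size_rcons exprS -mulrA.
by apply: le_trans (mean_sq_rcons k m0 jJ) _; rewrite ler_wpM2l// IH.
Qed.

Lemma mean_sqS k : mean_sq k.+1 [::] = mean_sq k (enum 'I_s).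
Proof.
by apply: eq_Rintegral => e _; rewrite /sweep_error partial_proj_nil mul1mx.
Qed.

Lemma mean_sq_le k : (0 < m)%N -> 0 <= 1 - c / (C * m%:R) ->
  mean_sq k [::] <= ((1 - c / (C * m%:R)) ^+ s) ^+ k * dot z0 z0.
Proof.
move=> m0 r0; elim: k => [|k IH].
  rewrite mul1r /mean_sq (_ : (fun e : Omega => _) = cst (dot z0 z0)); last first.
    by apply/funext => e; rewrite /sweep_error partial_proj_nil mul1mx.
  by rewrite Rintegral_cst// [X in fine X](probability_setT mu) mulr1.
rewrite mean_sqS exprS -mulrA.
apply: le_trans (mean_sq_uniq k m0 r0 (enum_uniq _)) _.
by rewrite size_enum_ord ler_wpM2l// exprn_ge0.
Qed.

(** If [Q != 0] then [Q A^T] has a nonzero entry in some column [i], and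
    [Q A^T g = 0] would express the [i]-th coordinate of [g] through data
    independent of it, which [coord_neq] excludes almost surely. *)
Lemma ae_rank_drop k J j : row_free A^T -> j \notin J ->
  {ae mu, forall e, partial_proj k J e != 0 ->
    partial_proj k J e *m (A^T *m col j (sample_mx e k)) != 0}.
Proof.
move=> Afree jJ; pose W e := partial_proj k J e *m A^T.
have mW : measurable_mx W.
  exact: (measurable_mx_mul (@measurable_partial_proj k J)
    (measurable_mx_cst A^T)).
pose Y (pi : 'I_n * 'I_m) (e : Omega) :=
  - (\sum_(l | l != pi.2) W e pi.1 l * e (k, l, j)) / W e pi.1 pi.2.
have Y_null pi : {ae mu, forall e : Omega, e (k, pi.2, j) != Y pi e}.
  have mY : measurable_fun setT (Y pi).
    have -> : Y pi = (fun e : Omega => - (\sum_l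
        (if l != pi.2 then W e pi.1 l * e (k, l, j) else 0)) / W e pi.1 pi.2).
      by apply/funext => e; rewrite /Y big_mkcond.
    apply: measurable_funM; last by apply: measurable_funV; exact: mW.
    apply: measurable_funN.
    apply: measurable_sum => l; have [_|_] := eqVneq l pi.2 => //=.
    by apply: measurable_funM; [exact: mW|exact: measurable_coord].
  exists [set e | e (k, pi.2, j) = Y pi e]; split => //.
  - have -> : [set e | e (k, pi.2, j) = Y pi e] =
        (fun e : Omega => e (k, pi.2, j) - Y pi e) @^-1` [set 0].
      apply/seteqP; split=> e /=; first by move=> ->; rewrite subrr.
      by move=> /eqP; rewrite subr_eq0 => /eqP.
    rewrite -[X in measurable X]setTI.
    have mD : measurable_fun setT (fun e : Omega => e (k, pi.2, j) - Y pi e).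
      by apply: measurable_funB => //; exact: measurable_coord.
    exact: (mD _ _ (measurable_set1 0)).
  - apply: (coord_neq mu_law nu_atomless mY) => e e' ee'.
    have We : W e = W e'.
      rewrite /W (@partial_proj_ignores k j k J _ e e') ?jJ ?orbT// => i ic.
      by apply: ee'; exact: ic.
    rewrite /Y We; congr (- _ / _); apply: eq_bigr => l lpi; congr (_ * _).
    by apply: ee'; apply/eqP => -[lE]; rewrite lE eqxx in lpi.
  - by move=> e /= /negP; rewrite negbK => /eqP.
have : {ae mu, forall e : Omega, forall pi, e (k, pi.2, j) != Y pi e}.
  by apply: filter_forall => pi; exact: Y_null.
apply: filterS => e eY Q0; apply/eqP => Qa0.
have /matrix0Pn[p [i Wpi]] : W e != 0.
  apply: contra Q0 => /eqP W0; apply/eqP/(row_free_inj Afree).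
  by rewrite mul0mx.
have : (W e *m col j (sample_mx e k)) p 0 = 0 by rewrite /W -mulmxA Qa0 mxE.
have gE l : col j (sample_mx e k) l 0 = e (k, l, j) by rewrite !mxE.
rewrite mxE (bigD1 i)//= gE => /eqP; rewrite addr_eq0 => /eqP WY.
have /negP := eY (p, i); apply; apply/eqP; rewrite /Y/=.
under eq_bigr do rewrite -gE.
by rewrite -WY mulrAC divff ?mul1r.
Qed.

Lemma ae_trace k J : row_free A^T -> uniq J ->
  {ae mu, forall e, partial_proj k J e = 0 \/
    \tr (partial_proj k J e) = n%:R - (size J)%:R}.
Proof.
move=> Afree; elim/last_ind: J => [_|J j IH].
  by apply: nearW => e; right; rewrite partial_proj_nil mxtrace1 subr0.
rewrite rcons_uniq => /andP[jJ uJ].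
apply: filterS2 (IH uJ) (ae_rank_drop k Afree jJ) => e [Q0 _|trQ].
  by left; rewrite partial_proj_rcons Q0 /deflate !mul0mx scaler0 subr0.
have [Q0 _|Q0 /(_ isT) Qa] := eqVneq (partial_proj k J e) 0.
  by left; rewrite partial_proj_rcons Q0 /deflate !mul0mx scaler0 subr0.
right; rewrite partial_proj_rcons deflate_trace trQ Qa size_rcons.
by rewrite -addrA -opprD natr1.
Qed.

(** Once the block is at least as large as the dimension, a single iteration
    solves the system almost surely. *)
Lemma ae_partial_proj0 k : row_free A^T -> (n <= s)%N ->
  {ae mu, forall e, partial_proj k (enum 'I_s) e = 0}.
Proof.
move=> Afree ns; have := ae_trace k Afree (enum_uniq 'I_s).
apply: filterS => e [//|trQ].
have [Qs QQ] := orthoprojP (sketch_rows A (sample_mx e k) (enum 'I_s)).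
apply: (proj_trace_le0 Qs QQ).
by rewrite [leLHS]trQ size_enum_ord subr_le0 ler_nat.
Qed.

Lemma mean_sq_eq0 k : row_free A^T -> (n <= s)%N -> mean_sq k.+1 [::] = 0.
Proof.
move=> Afree ns; rewrite mean_sqS.
transitivity (\int[mu]_e (cst 0 : Omega -> R) e)%R; last first.
  by rewrite Rintegral_cst// mul0r.
apply: ae_eq_Rintegral => //; first exact: (bounded_measurable_sweep k _).1.
apply: filterS (ae_partial_proj0 k Afree ns) => e Q0.
by rewrite /sweep_error Q0 mul0mx dot0r.
Qed.

End Kaczmarz.

(** * The convergence theorem *)

Section Rate.
Context {R : realType}.

(** Bernoulli's inequality applied to the reciprocal:
    [(1 - x)^s <= 1 / (1 + s x)]. *)
Lemma geometric_rate_le (x : R) (s : nat) : 0 <= x <= 1 -> s%:R * x <= 1 ->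
  (1 - x) ^+ s <= 1 - s%:R * x / 2.
Proof.
move=> /andP[x0 x1] sx1.
have : (1 - x) ^+ s * (1 + s%:R * x) <= 1.
  elim: s {sx1} => [|s IH]; first by rewrite mul0r addr0 mul1r.
  apply: le_trans IH; rewrite exprSr -mulrA ler_wpM2l ?exprn_ge0 ?subr_ge0//.
  by rewrite -natr1; have : 0 <= s%:R :> R by []; nra.
have : 0 <= (1 - x) ^+ s by rewrite exprn_ge0// subr_ge0.
have : 0 <= s%:R * x by rewrite mulr_ge0.
move: sx1; move: (s%:R * x) ((1 - x) ^+ s) => t p; nra.
Qed.

End Rate.

Section Law.
Context d (T : measurableType d) (R : realType) (P : probability T R).
Context (I : choiceType).
Variable G : I -> {RV P >-> R}.

(** The joint law of the whole family is the image of [P] under this map. *)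
Definition joint_map (w : T) : @coords R I := fun i => G i w.

Lemma measurable_joint_map : measurable_fun setT joint_map.
Proof. by apply: measurable_fun_coords => i; exact: measurable_funPT. Qed.

HB.instance Definition _ := isMeasurableFun.Build _ _ _ _ joint_map measurable_joint_map.

Lemma iid_product_law : iid_std_normal G ->
  product_law (normal_prob 0 1) (distribution P joint_map).
Proof.
move=> [G_normal G_indep] J B uJ mB.
transitivity (P (\bigcap_(i in [set` J]) (G i @^-1` B i))).
  by rewrite /distribution /pushforward; congr (P _).
rewrite G_indep//; apply: eq_bigr => i _.
by rewrite -(G_normal i)//; exact: mB.
Qed.

End Law.

Theorem theorem2p1 (R : realType) (m n s : nat) (A : 'M[R]_(m, n))
    (b : 'cV[R]_m) (xstar x0 : 'cV[R]_n)
    (d : measure_display) (T : measurableType d) (P : probability T R)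
    (G : nat * 'I_m * 'I_s -> {RV P >-> R}) :
  (n <= m)%N ->
  \rank A = n ->
  kappa2 A <= expR (m%:R / 4) / 3 ->
  A *m xstar = b ->
  (0 < s)%N ->
  0 <= 1 - s%:R / (15 * m%:R * kappa2 A) ->
  iid_std_normal G ->
  forall k : nat,
    ('E_P[fun w => (norm2 (bgk A b (random_mx G w) x0 k - xstar) ^+ 2)%R] <=
      ((1 - s%:R / (15 * m%:R * kappa2 A)) ^+ k *
        norm2 (x0 - xstar) ^+ 2)%:E)%E.
Proof.
move=> nm rankA _ Axb s_gt0 rate_ge0 G_iid k.
move: n A xstar x0 nm rankA Axb rate_ge0.
case=> [|n] A xstar x0 nm rankA Axb rate_ge0.
  rewrite (_ : (fun w => _) = cst 0); last first.
    by apply/funext => w; rewrite norm2_sqr dotE big_ord0.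
  by rewrite expectation_cst norm2_sqr dotE big_ord0 mulr0.
have m_gt0 : (0 < m)%N by exact: leq_ltn_trans nm.
have mR : 0 < m%:R :> R by rewrite ltr0n.
set z0 := x0 - xstar.
have mu_law := iid_product_law G_iid.
pose mu := distribution P (joint_map G).
have nu_sym (B : set R) : measurable B ->
    normal_prob 0 1 (-%R @^-1` B) = normal_prob (0 : R) 1 B.
  exact: normal_probN.
have [smin_gt0 smax_gt0 kappa_ge1] := sigma_kappa2_bounds rankA.
have [_ sA] := singular_value_bounds rankA.
have A_ge x := proj1 (andP (sA x)); have A_le x := proj2 (andP (sA x)).
have -> : ('E_P[fun w => (norm2 (bgk A b (random_mx G w) x0 k - xstar) ^+ 2)%R] =
    (mean_sq A z0 mu k [::])%:E)%E.
  rewrite unlock /mean_sq /Rintegral fineK; last first.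
    apply: integrable_fin_num => //.
    exact: (bounded_measurable_integrable mu
      (bounded_measurable_sweep A z0 k [::])).
  rewrite (@ge0_integral_distribution _ _ _ _ _ P (joint_map G)
    (fun e => (dot (sweep_error A z0 k [::] e) (sweep_error A z0 k [::] e))%:E)).
  - apply: eq_integral => w _ /=.
    by rewrite norm2_sqr (bgk_errorE _ _ _ Axb) /sweep_error partial_proj_nil mul1mx.
  - by apply/measurable_EFinP; exact: (bounded_measurable_sweep A z0 k [::]).1.
  - by move=> e; rewrite lee_fin dot_ge0.
rewrite lee_fin norm2_sqr -/z0.
(* The contraction factor of one column is [1 - x], with [x = 1 / (m kappa2 A)]. *)
set x := sigma_min A ^+ 2 / (sigma_max A ^+ 2 * m%:R).
have xE : s%:R / (15 * m%:R * kappa2 A) = s%:R * x / 15.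
  rewrite /x /kappa2; field.
  have s1 : sigma_min A != 0 by rewrite -sqrf_eq0 gt_eqF.
  have s2 : sigma_max A != 0 by rewrite -sqrf_eq0 gt_eqF.
  by rewrite s1 s2 (gt_eqF mR).
have Cm_gt0 : 0 < sigma_max A ^+ 2 * m%:R by rewrite mulr_gt0.
have x01 : 0 <= x <= 1.
  apply/andP; split; first by rewrite divr_ge0// ltW.
  rewrite /x ler_pdivrMr// mul1r.
  have s12 : sigma_min A ^+ 2 <= sigma_max A ^+ 2.
    by move: kappa_ge1; rewrite /kappa2 ler_pdivlMr// mul1r.
  by apply: le_trans s12 _; rewrite ler_peMr ?(ltW smax_gt0)// ler1n.
have iter_le k' := mean_sq_le z0 mu_law normal_prob_set1 nu_sym
  smax_gt0 A_ge A_le k' m_gt0.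
have x1 : 0 <= 1 - x by rewrite subr_ge0; case/andP: x01.
(* A block of at least [n.+1] columns annihilates the error after one iteration,
   whereas a smaller one has [s x <= s / m < 1], where the geometric rate is
   better than the linear one. *)
have [ns|sn] := ltnP n s.
  case: k => [|k]; first by have := iter_le 0%N x1; rewrite !expr0.
  rewrite (mean_sq_eq0 _ mu_law normal_prob_set1)//.
    by rewrite mulr_ge0 ?exprn_ge0 ?dot_ge0.
  by rewrite /row_free mxrank_tr rankA.
apply: le_trans (iter_le k x1) _; rewrite ler_wpM2r ?dot_ge0//.
have sx_le1 : s%:R * x <= 1.
  rewrite /x mulrA ler_pdivrMr// mul1r mulrC.
  rewrite ler_pM ?(ltW smin_gt0)//.
    by move: kappa_ge1; rewrite /kappa2 ler_pdivlMr// mul1r.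
  by rewrite ler_nat (leq_trans sn)// ltnW.
have sx_ge0 : 0 <= s%:R * x by rewrite mulr_ge0//; case/andP: x01.
rewrite lerXn2r ?nnegrE ?exprn_ge0// xE.
by apply: le_trans (geometric_rate_le x01 sx_le1) _; lra.
Qed.
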